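(* Let $\gamma$ be a weak composition of length $n$ and let $\alpha=\gamma^+$. The set of column-strict composition tableaux of shape $\alpha$ with first column $\mathcal{F}(\gamma)$ is in bijection with the set of composition array patterns of shape $\gamma$.
   Context: A weak composition of length $n$ is a sequence $\gamma=(\gamma_1,\dots,\gamma_n)$ of nonnegative integers; $\gamma^+$ is the sequence obtained by deleting its zero parts; $\mathcal{F}(\gamma)=\{i\mid\gamma_i>0\}$. The diagram of $\alpha$ has left-justified rows with $\alpha_i$ boxes in row $i$ from the top. A column-strict composition tableau (CT) of shape $\alpha$ (with $k$ parts, all positive, and largest part $m$) is a filling $U$ of the diagram of $\alpha$ with positive integers such that (1) the first column is strictly increasing from top to bottom; (2) each row is weakly decreasing from left to right; (3) (Triple Rule) if $\hat U$ is the $k\times m$ array obtained by adding zeros at the ends of the rows of $U$, then for $1\le i_1<i_2\le k$ and $2\le j\le m$: if $\hat U(i_2,j)\neq0$ and $\hat U(i_2,j)\ge\hat U(i_1,j)$ then $\hat U(i_2,j)>\hat U(i_1,j-1)$. ''First column $\mathcal{F}(\gamma)$'' means that the set of entries in the first column is $\mathcal{F}(\gamma)$. A composition array pattern of shape $\gamma$ is a triangular array $X_n^\gamma=(x_{i,j})$, $1\le i\le n$, $1\le j\le n-i+1$, of nonnegative integers such that (1) $\gamma_i=x_{1,i}$ for $1\le i\le n$; (2) $x_{i,j}\le x_{i-1,j+1}$ for $2\le i\le n$, $1\le j\le n-i+1$; (3) for all $1\le i\le n-1$ and all $0\le r<s\le n-i$, with the convention $x_{l,0}=0$ for all $l$: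 (a) if $x_{i+1,r}\ge x_{i+1,s}$ then $x_{i+1,r}\ge x_{i,s+1}$; and (b) if $x_{i+1,r}<x_{i+1,s}<x_{i,s+1}$ then $x_{i,r+1}<x_{i+1,s}$. *)

(* Defs.v *)
From mathcomp Require Import all_boot.
From mathcomp Require Import classical_sets functions.

Set Implicit Arguments.
Unset Strict Implicit.
Unset Printing Implicit Defensive.

Local Open Scope classical_set_scope.

(* A weak composition of length n is an n.-tuple of naturals; parts are
   numbered from 1, and out-of-range indices (including 0) give 0. *)
Definition part (gamma : seq nat) (i : nat) : nat := nth 0 (0 :: gamma) i.

Definition flat (gamma : seq nat) : seq nat := [seq g <- gamma | 0 < g].

Definition pos_parts (gamma : seq nat) : set nat := [set i | 0 < part gamma i].

(* Arrays (tableaux and triangular patterns) are lists of left-justified rows,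
   from top to bottom.  [entry T i j] is the entry in row i and column j, both
   numbered from 1; it is 0 in row 0, in column 0 and outside the array.  This
   provides both the zero-padded array \hat U of a tableau U and the convention
   x_{l,0} = 0 for patterns. *)
Definition entry (T : seq (seq nat)) (i j : nat) : nat :=
  nth 0 (0 :: nth [::] ([::] :: T) i) j.

Definition first_column (U : seq (seq nat)) : seq nat := map (head 0) U.

(* Meant for compositions alpha, i.e., sequences of positive integers. *)
Record is_CT (alpha : seq nat) (U : seq (seq nat)) : Prop := {
  CT_shape : shape U = alpha;
  CT_pos : all (all (fun x => 0 < x)) U;
  CT_col : sorted ltn (first_column U);
  CT_row : all (sorted geq) U;
  CT_triple : forall i1 i2 j : nat,
    1 <= i1 -> i1 < i2 -> i2 <= size alpha ->
    2 <= j -> j <= \max_(a <- alpha) a ->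
    entry U i2 j != 0 -> entry U i2 j >= entry U i1 j ->
    entry U i2 j > entry U i1 (j - 1)
}.

Definition CT_first_col (alpha : seq nat) (F : set nat) : set (seq (seq nat)) :=
  [set U | is_CT alpha U /\ [set` first_column U] = F].

(* The shape [:: n; n - 1; ...; 1] makes row i consist of n - i + 1 entries. *)
Record is_CAP (n : nat) (gamma : n.-tuple nat) (X : seq (seq nat)) : Prop := {
  CAP_shape : shape X = rev (iota 1 n);
  CAP_top : forall i, 1 <= i <= n -> part gamma i = entry X 1 i;
  CAP_le : forall i j, 2 <= i <= n -> 1 <= j <= n - i + 1 ->
    entry X i j <= entry X i.-1 j.+1;
  CAP_a : forall i r s, 1 <= i <= n - 1 -> r < s <= n - i ->
    entry X i.+1 r >= entry X i.+1 s -> entry X i.+1 r >= entry X i s.+1;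
  CAP_b : forall i r s, 1 <= i <= n - 1 -> r < s <= n - i ->
    entry X i.+1 r < entry X i.+1 s < entry X i s.+1 ->
    entry X i r.+1 < entry X i.+1 s
}.

Definition CAP (n : nat) (gamma : n.-tuple nat) : set (seq (seq nat)) :=
  [set X | is_CAP gamma X].

(* Main.v *)
Require Import Defs.
From mathcomp Require Import all_boot.
From mathcomp Require Import classical_sets functions.
From mathcomp Require Import zify.

Set Implicit Arguments.
Unset Strict Implicit.
Unset Printing Implicit Defensive.

(* Label the rows of U by their first entries, so that row p has gamma_p boxes,
   and let x_{i,j} be the number of entries >= i in row i + j - 1 of U.  Then
   the p-th antidiagonal x_{1,p}, x_{2,p-1}, ..., x_{p,1} of X is the partition
   conjugate to row p of U, so X and U determine each other.  For p < q, writing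
   P, P' (resp. Q, Q') for the numbers of entries >= v, > v in row p (resp. q),
   the triple rule for these rows says that, for every v >= 1, no j >= 2
   satisfies max(P', Q') < j <= min(P + 1, Q); this amounts to conditions (a)
   and (b). *)

(** * Conjugation of decreasing functions *)

Lemma ltn_ext a b : (forall v, (v < a) = (v < b)) -> a = b.
Proof. by move=> h; have := h a; have := h b; lia. Qed.

(** A downward closed [P] holds on an initial segment, so counting it below [m] measures the length
    of that segment. *)
Lemma ltn_count_iota (P : pred nat) m v :
  (forall i, P i.+1 -> P i) -> (v < count P (iota 0 m)) = (v < m) && P v.
Proof.
elim: m P v => [|m IHm] P v dP //=.
have P0 i : P i -> P 0 by elim: i => // i IHi /dP.
have IH u : (u < count P (iota 1 m)) = (u < m) && P u.+1.
  by rewrite (iotaDl 1 0) count_map (IHm (fun i => P i.+1)) => // i /dP.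
case: v => [|v]; case: (boolP (P 0)) => hP; rewrite ?add1n ?add0n ?ltnS ?IH //.
- by apply/negP => /andP[_ /P0]; apply/negP.
- apply/idP/idP => /andP[]; first by move=> _ /P0; rewrite (negPf hP).
  by move=> _ /P0; rewrite (negPf hP).
Qed.

(** The conjugate partition of a decreasing [h] that vanishes from [m] on. *)
Definition conjugate (m : nat) (h : nat -> nat) (j : nat) : nat :=
  count (fun v => j < h v) (iota 0 m).

(** The relation is symmetric in a partition and its conjugate, which makes conjugation an
    involution. *)
Lemma ltn_conjugate m h v j :
  (forall i, h i.+1 <= h i) -> (forall i, m <= i -> h i = 0) ->
  (v < conjugate m h j) = (j < h v).
Proof.
move=> dh h0; rewrite ltn_count_iota => [|i /leq_trans -> //].
by case: ltnP => // /h0 ->.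
Qed.

Lemma part_out gamma p : size gamma < p -> part gamma p = 0.
Proof. by move=> h; rewrite /part nth_default. Qed.

(* [R p j] is the entry in column [j.+1] of the row with first entry [p]. *)
Record rows_ok (gamma : seq nat) (R : nat -> nat -> nat) : Prop := {
  rows_out : forall p j, part gamma p <= j -> R p j = 0;
  rows_head : forall p, 0 < part gamma p -> R p 0 = p;
  rows_mono : forall p j, R p j.+1 <= R p j;
  rows_pos : forall p j, j < part gamma p -> 0 < R p j;
  rows_triple : forall p q j, p < q ->
    0 < R q j.+1 -> R p j.+1 <= R q j.+1 -> R p j < R q j.+1
}.

(* [D p i] is [x_{i+1,p-i}]; the convention [x_{l,0} = 0] becomes [D p p = 0],
   and conditions (a) and (b) are taken at [r = p - i - 1], [s = q - i - 1]. *)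
Record diags_ok (gamma : seq nat) (D : nat -> nat -> nat) : Prop := {
  diags_out : forall p i, p <= i -> D p i = 0;
  diags_top : forall p, D p 0 = part gamma p;
  diags_mono : forall p i, D p i.+1 <= D p i;
  diags_a : forall p q i, i < p < q ->
    D q i.+1 <= D p i.+1 -> D q i <= D p i.+1;
  diags_b : forall p q i, i < p < q ->
    D p i.+1 < D q i.+1 < D q i -> D p i < D q i.+1
}.

(** By (a) at [p = i.+1], where [D p i.+1 = 0], a zero of [D q] at [i.+1] forces one at [i]. This is
    what makes row [q] start with [q]. *)
Lemma diags_pos gamma D q i :
  diags_ok gamma D -> 0 < part gamma q -> i < q -> 0 < D q i.
Proof.
move=> ok q_gt0; elim: i => [|i IHi] i_lt; first by rewrite (diags_top ok).
have := IHi (ltnW i_lt); have [D0|//] := posnP (D q i.+1).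
have /(diags_a ok) : i < i.+1 < q by rewrite ltnSn.
by rewrite D0 => /(_ isT); rewrite [D i.+1 _](diags_out ok) // leqn0 => /eqP ->.
Qed.

(** * The triple rule against conditions (a) and (b) *)

Section Conjugation.

Variables (gamma : seq nat) (R D : nat -> nat -> nat).
Hypothesis RD : forall p i j, (j < D p i) = (i < R p j).

Lemma diags_of_rows : rows_ok gamma R -> diags_ok gamma D.
Proof.
move=> ok.
have D_mono p i : D p i.+1 <= D p i.
  rewrite leqNgt RD; apply/negP => /ltnW.
  by rewrite -RD ltnn.
split=> //.
- move=> p i le_pi; apply/eqP; rewrite -leqn0 leqNgt RD -leqNgt.
  have [le0|/(rows_head ok) -> //] := leqP (part gamma p) 0.
  by rewrite (rows_out ok).
- move=> p; apply: ltn_ext => v; rewrite RD.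
  by case: (ltnP v) => [/(rows_pos ok) -> //|/(rows_out ok) ->].
(* If (a) fails, then at [d = D p i.+1] we get [R q d = i.+1] and [R p d <= i.+1]. For [d = 0] this
   is absurd, as [R q 0] is 0 or [q]; for [d = j.+1] the triple rule gives [R p j <= i], against
   [j < D p i]. *)
- move=> p q i /andP[lt_ip lt_pq] le_qp; rewrite leqNgt; apply/negP => lt_pq'.
  move: (RD q i (D p i.+1)) (RD q i.+1 (D p i.+1)) (RD p i.+1 (D p i.+1)).
  case Ej: (D p i.+1) => [|j].
    have [le0|/(rows_head ok) ->] := leqP (part gamma q) 0; last by lia.
    by rewrite (rows_out ok) //; lia.
  have := @rows_triple _ _ ok p q j lt_pq.
  by have := RD p i j; have := D_mono p i; lia.
(* The same argument at [d = D q i.+1], which is positive since it exceeds [D p i.+1]. *)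
- move=> p q i /andP[lt_ip lt_pq] /andP[lt_pq' lt_q]; rewrite ltnNge.
  apply/negP => le_qp.
  move: (RD q i (D q i.+1)) (RD q i.+1 (D q i.+1)) (RD p i.+1 (D q i.+1)).
  case Ej: (D q i.+1) => [|j]; first by lia.
  have := @rows_triple _ _ ok p q j lt_pq.
  by have := RD p i j; lia.
Qed.

Lemma rows_of_diags : diags_ok gamma D -> rows_ok gamma R.
Proof.
move=> ok; split.
- move=> p j le_j; apply/eqP; rewrite -leqn0 leqNgt -RD (diags_top ok).
  by rewrite -leqNgt.
- move=> p p_gt0; apply: ltn_ext => v; rewrite -RD.
  by case: (ltnP v) => [/(diags_pos ok p_gt0) -> //|/(diags_out ok) ->].
- move=> p j; rewrite leqNgt -RD; apply/negP => /ltnW.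
  by rewrite RD ltnn.
- by move=> p j; rewrite -RD (diags_top ok).
- move=> p q j lt_pq R_gt0 le_pq; rewrite ltnNge; apply/negP => le_qp.
  (* With [R q j.+1 = i.+1], a violation means that [D p i.+1] and [D q i.+1] are at most
     [j.+1 < D q i], while [j < D p i]. This contradicts (a) if [D q i.+1 <= D p i.+1] and (b)
     otherwise; [p <= i] is excluded by [D p i = 0]. *)
  move: (RD q (R q j.+1).-1 j.+1) (RD q (R q j.+1) j.+1) (RD p (R q j.+1) j.+1)
        (RD p (R q j.+1).-1 j) R_gt0 le_pq le_qp.
  case: (R q j.+1) => [//|i] /=.
  have := @diags_a _ _ ok p q i; have := @diags_b _ _ ok p q i.
  have [|le_pi] := ltnP i p; first by lia.
  by have := diags_out ok le_pi; lia.
Qed.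

End Conjugation.

(** * Tableaux as families of rows labelled by their first entries *)

Definition row (U : seq (seq nat)) (p j : nat) : nat :=
  nth 0 (nth [::] U (index p (first_column U))) j.

Definition supp (gamma : seq nat) : seq nat :=
  [seq p <- iota 1 (size gamma) | 0 < part gamma p].

Definition tableau (gamma : seq nat) (R : nat -> nat -> nat) : seq (seq nat) :=
  [seq mkseq (R p) (part gamma p) | p <- supp gamma].

Lemma mem_supp gamma p : (p \in supp gamma) = (0 < part gamma p).
Proof.
rewrite mem_filter mem_iota; case: (ltnP (size gamma) p) => [/part_out ->|] //.
by case: p => [|p] le_p; rewrite ?andbT //=; lia.
Qed.

Lemma supp_sorted gamma : sorted ltn (supp gamma).
Proof. by apply: (sorted_filter ltn_trans); exact: iota_ltn_sorted. Qed.

Lemma nth_supp_lt gamma i1 i2 : i1 < i2 -> i2 < size (supp gamma) ->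
  nth 0 (supp gamma) i1 < nth 0 (supp gamma) i2.
Proof.
move=> lt_i lt_i2; have lt_i1 := ltn_trans lt_i lt_i2.
exact: (sorted_ltn_nth ltn_trans 0 (supp_sorted gamma) i1 i2 lt_i1 lt_i2 lt_i).
Qed.

Lemma flatE gamma : flat gamma = map (part gamma) (supp gamma).
Proof.
rewrite /flat /supp; have <- := filter_map (part gamma) (ltn 0); congr filter.
apply: (@eq_from_nth _ 0) => [|i lt_i]; first by rewrite size_map size_iota.
by rewrite (nth_map 0) ?size_iota // nth_iota.
Qed.

Lemma size_flat gamma : size (flat gamma) = size (supp gamma).
Proof. by rewrite flatE size_map. Qed.

Section Tableaux.

Variables (gamma : seq nat) (R : nat -> nat -> nat).
Hypothesis R_ok : rows_ok gamma R.

Lemma first_column_tableau : first_column (tableau gamma R) = supp gamma.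
Proof.
rewrite /first_column -map_comp -[RHS]map_id; apply/eq_in_map => q.
rewrite mem_supp => q_gt0 /=; rewrite -[RHS](rows_head R_ok q_gt0).
by case: (part gamma q) q_gt0.
Qed.

Lemma nth_mkseq_rows p j : nth 0 (mkseq (R p) (part gamma p)) j = R p j.
Proof.
have [?|le_j] := ltnP j (part gamma p); first by rewrite nth_mkseq.
by rewrite nth_default ?size_mkseq // (rows_out R_ok).
Qed.

Lemma row_tableau p j : row (tableau gamma R) p j = R p j.
Proof.
rewrite /row first_column_tableau.
have [p_in|p_out] := boolP (p \in supp gamma).
  by rewrite (nth_map 0) ?index_mem // nth_index // nth_mkseq_rows.
(* The index of an absent label is past the last row, so [row] reads the default empty row. *)
rewrite (rows_out R_ok); last by move: p_out; rewrite mem_supp; lia.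
by rewrite [nth [::] _ _]nth_default ?nth_nil // size_map memNindex.
Qed.

Lemma entry_tableau i j : i < size (supp gamma) ->
  entry (tableau gamma R) i.+1 j.+1 = R (nth 0 (supp gamma) i) j.
Proof. by move=> lt_i; rewrite /entry /= (nth_map 0) ?nth_mkseq_rows. Qed.

Lemma tableau_CT :
  CT_first_col (flat gamma) (pos_parts gamma) (tableau gamma R).
Proof.
split; last first.
  rewrite first_column_tableau; apply/seteqP.
  by split=> x /=; rewrite mem_supp.
split.
- rewrite flatE /shape -map_comp; apply: eq_map => p /=; exact: size_mkseq.
- rewrite all_map; apply/allP => p _; apply/(all_nthP 0) => j.
  by rewrite size_mkseq nth_mkseq_rows; apply: (rows_pos R_ok).
- rewrite first_column_tableau; exact: supp_sorted.
- rewrite all_map; apply/allP => p _; apply/(sortedP 0) => j _.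
  by rewrite /= !nth_mkseq_rows; apply: (rows_mono R_ok).
- move=> i1 i2 j i1_gt0 lt_i; rewrite size_flat => lt_i2 j_gt1 _.
  case: i1 i2 j i1_gt0 lt_i lt_i2 j_gt1
    => [|i1] [|i2] [|[|j]] // _ lt_i lt_i2 _.
  have lt_i1 : i1 < size (supp gamma) by apply: ltn_trans lt_i2.
  rewrite subn1 /= !entry_tableau // -lt0n; apply: (rows_triple R_ok).
  exact: nth_supp_lt.
Qed.

End Tableaux.

(** * The row family of a given tableau *)

Section TableauOf.

Variables (gamma : seq nat) (U : seq (seq nat)).
Hypothesis U_CT : CT_first_col (flat gamma) (pos_parts gamma) U.

Let U_ok : is_CT (flat gamma) U := U_CT.1.

(** Strictly increasing lists with the same members coincide, so the set of first entries determines
    the column. *)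
Lemma first_column_CT : first_column U = supp gamma.
Proof.
apply: (irr_sorted_eq ltn_trans ltnn (CT_col U_ok) (supp_sorted gamma)) => p.
rewrite mem_supp; have /seteqP[sub1 sub2] := U_CT.2.
by apply/idP/idP => [/sub1|/sub2].
Qed.

Lemma size_CT : size U = size (supp gamma).
Proof. by rewrite -first_column_CT size_map. Qed.

Lemma nth_CT_row i j : i < size U ->
  nth 0 (nth [::] U i) j = row U (nth 0 (supp gamma) i) j.
Proof.
move=> lt_i; rewrite /row first_column_CT index_uniq -?size_CT //.
exact: (sorted_uniq ltn_trans ltnn (supp_sorted gamma)).
Qed.

Lemma size_nth_CT i : i < size U ->
  size (nth [::] U i) = part gamma (nth 0 (supp gamma) i).
Proof.
move=> lt_i; rewrite -(nth_map 0 0 (part gamma)) -?size_CT // -flatE.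
by rewrite -(CT_shape U_ok) /shape (nth_map [::]).
Qed.

Lemma tableau_row : tableau gamma (row U) = U.
Proof.
apply: (@eq_from_nth _ [::]); rewrite size_map -size_CT // => i lt_i.
rewrite (nth_map 0) -?size_CT // -(size_nth_CT lt_i).
apply: (@eq_from_nth _ 0); rewrite size_mkseq // => j lt_j.
by rewrite nth_mkseq // nth_CT_row.
Qed.

Lemma row_supp p : 0 < part gamma p ->
  exists2 i, i < size U & p = nth 0 (supp gamma) i.
Proof.
rewrite -mem_supp => p_in; exists (index p (supp gamma)).
  by rewrite size_CT index_mem.
by rewrite nth_index.
Qed.

Lemma row_out p j : part gamma p <= j -> row U p j = 0.
Proof.
have [p_eq0 _|/row_supp[i lt_i ->]] := posnP (part gamma p).
  rewrite /row first_column_CT memNindex ?mem_supp ?p_eq0 // -size_CT.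
  by rewrite [nth [::] _ _]nth_default ?nth_nil.
by rewrite -nth_CT_row // -size_nth_CT //; apply: nth_default.
Qed.

Lemma row_ok : rows_ok gamma (row U).
Proof.
split.
- exact: row_out.
- move=> p /row_supp[i lt_i ->]; rewrite -nth_CT_row // -first_column_CT.
  by rewrite (nth_map [::]) // nth0.
- move=> p j; have [/row_out -> //|lt_j] := leqP (part gamma p) j.+1.
  have /row_supp[i lt_i Ep] : 0 < part gamma p by apply: leq_trans lt_j.
  move: lt_j; rewrite {}Ep -!nth_CT_row // -size_nth_CT //.
  by have /all_nthP/(_ i lt_i)/(sortedP 0) := CT_row U_ok; apply.
- move=> p j lt_j.
  have /row_supp[i lt_i Ep] : 0 < part gamma p by apply: leq_trans lt_j.
  move: lt_j; rewrite {}Ep -!nth_CT_row // -size_nth_CT //.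
  by have /all_nthP/(_ i lt_i)/(all_nthP 0) := CT_pos U_ok; apply.
- move=> p q j lt_pq q_gt0.
  have lt_j : j.+1 < part gamma q.
    by rewrite ltnNge; apply/negP => /row_out q0; rewrite q0 in q_gt0.
  (* If part [p] is zero, row [p] is absent and reads as 0, below the positive entry of row [q]. *)
  have [p0|/row_supp[i1 lt_i1 Ep]] := posnP (part gamma p).
    by rewrite [row U p j]row_out ?p0.
  have part_q : 0 < part gamma q by apply: leq_trans lt_j.
  have /row_supp[i2 lt_i2 Eq] := part_q.
  have lt_i : i1 < i2.
    rewrite ltnNge; apply/negP => le_i; move: lt_pq; rewrite Ep Eq.
    have [<-|lt_i] := eqVneq i2 i1; first by rewrite ltnn.
    rewrite ltnNge ltnW //.
    by apply: nth_supp_lt; rewrite -?size_CT // ltn_neqAle lt_i.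
  (* Columns are numbered from 1 in [entry] and from 0 in [row], hence [j.+2]. It is at most the
     part of index [q], hence at most the largest part. *)
  have := @CT_triple _ _ U_ok i1.+1 i2.+1 j.+2; rewrite subn1 /=.
  rewrite /entry /= !nth_CT_row // -Ep -Eq -lt0n; apply=> //.
    by rewrite size_flat -size_CT.
  apply: leq_trans lt_j _; rewrite flatE big_map.
  by apply: leq_bigmax_seq; rewrite // mem_supp.
Qed.

End TableauOf.

(** * Patterns as families of antidiagonals *)

Definition triangle (n : nat) (D : nat -> nat -> nat) : seq (seq nat) :=
  mkseq (fun i => mkseq (fun j => D (i + j).+1 i) (n - i)) n.

(** For [p <= i] truncated subtraction gives column 0, where [entry] is 0. *)
Definition diag (X : seq (seq nat)) (p i : nat) : nat := entry X i.+1 (p - i).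

Lemma shape_triangle n D : shape (triangle n D) = rev (iota 1 n).
Proof.
rewrite /shape -map_comp; apply: (@eq_from_nth _ 0).
  by rewrite size_rev !size_map !size_iota.
rewrite size_map size_iota => i lt_i.
rewrite (nth_map 0) ?size_iota // nth_iota //= size_mkseq nth_rev ?size_iota //.
by rewrite nth_iota; lia.
Qed.

Section Patterns.

Variables (n : nat) (gamma : n.-tuple nat).

Lemma entry_triangle D i r : diags_ok gamma D -> i < n -> i + r <= n ->
  entry (triangle n D) i.+1 r = D (i + r) i.
Proof.
move=> ok lt_i; case: r => [|r] le_ir; first by rewrite addn0 (diags_out ok).
by rewrite /entry /= !nth_mkseq ?addnS //; lia.
Qed.

Lemma diag_triangle D p i : diags_ok gamma D -> diag (triangle n D) p i = D p i.
Proof.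
move=> ok; rewrite /diag; have [le_pi|lt_ip] := leqP p i.
  by rewrite (eqP le_pi) (diags_out ok).
have [le_pn|lt_np] := leqP p n; first by rewrite entry_triangle ?subnKC //; lia.
(* Beyond [n], [D p] decreases from a zero part. *)
have D0 : D p i = 0.
  apply/eqP; rewrite -leqn0; elim: i {lt_ip} => [|i].
    by rewrite (diags_top ok) part_out ?size_tuple.
  by apply: leq_trans; exact: (diags_mono ok).
rewrite D0 /entry; have -> : p - i = (p - i.+1).+1 by lia.
have [lt_in|le_ni] /= := ltnP i n.
  by rewrite nth_default // nth_mkseq // size_mkseq; lia.
by rewrite [nth [::] _ _]nth_default ?nth_nil ?size_mkseq.
Qed.

Lemma triangle_CAP D : diags_ok gamma D -> CAP gamma (triangle n D).
Proof.
move=> ok; split.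
- exact: shape_triangle.
- by move=> i le_i; rewrite entry_triangle ?(diags_top ok) //; lia.
- move=> [|[|i]] j le_i le_j; [lia|lia|rewrite !entry_triangle //; try by lia].
  by rewrite addnS; apply: (diags_mono ok).
(* Entry [r] of row [i.+2] lies on antidiagonal [p = i.+1 + r], so [r = 0] becomes [p = i.+1]. *)
- move=> [|i] r s le_i lt_rs; [lia|rewrite !entry_triangle //; try by lia].
  by rewrite addnS; apply: (diags_a ok); lia.
- move=> [|i] r s le_i lt_rs; [lia|rewrite !entry_triangle //; try by lia].
  by rewrite !addnS; apply: (diags_b ok); lia.
Qed.

Section DiagonalsOf.

Variable X : seq (seq nat).
Hypothesis X_CAP : is_CAP gamma X.

Lemma size_CAP : size X = n.
Proof.
by rewrite -(size_map size) -/(shape X) (CAP_shape X_CAP) size_rev size_iota.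
Qed.

Lemma size_nth_CAP i : i < n -> size (nth [::] X i) = n - i.
Proof.
move=> lt_i; rewrite -(nth_map [::] 0 size) ?size_CAP // -/(shape X).
by rewrite (CAP_shape X_CAP) nth_rev size_iota // nth_iota; lia.
Qed.

Lemma triangle_diag : triangle n (diag X) = X.
Proof.
apply: (@eq_from_nth _ [::]); rewrite size_mkseq ?size_CAP // => i lt_i.
rewrite nth_mkseq //; apply: (@eq_from_nth _ 0).
  by rewrite size_mkseq size_nth_CAP.
rewrite size_mkseq => j lt_j; rewrite nth_mkseq // /diag.
by have -> : (i + j).+1 - i = j.+1 by lia.
Qed.

Lemma diag_out p i : p <= i -> diag X p i = 0.
Proof. by rewrite /diag => /eqP ->. Qed.

Lemma diag_big p i : n < p -> diag X p i = 0.
Proof.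
move=> lt_np; have [/diag_out -> //|lt_ip] := leqP p i.
rewrite /diag /entry; have -> : p - i = (p - i.+1).+1 by lia.
have [lt_in|le_ni] /= := ltnP i n.
  by rewrite nth_default // size_nth_CAP //; lia.
by rewrite [nth [::] _ _]nth_default ?nth_nil ?size_CAP.
Qed.

Lemma diag_ok : diags_ok gamma (diag X).
Proof.
split.
- exact: diag_out.
- move=> p; have [lt_np|le_pn] := ltnP n p.
    by rewrite diag_big // part_out ?size_tuple.
  by case: p le_pn => // p lt_p; rewrite (CAP_top X_CAP).
- move=> p i; have [lt_np|le_pn] := ltnP n p; first by rewrite !diag_big.
  have [/diag_out -> //|lt_ip] := leqP p i.+1.
  have := @CAP_le _ _ _ X_CAP i.+2 (p - i.+1); rewrite /diag /=.
  have -> : (p - i.+1).+1 = p - i by lia.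
  by apply; lia.
- move=> p q i /andP[lt_ip lt_pq].
  (* Antidiagonal [q] is zero here, so the conclusion of (a) is trivial. *)
  have [lt_nq|le_qn] := ltnP n q; first by rewrite !(@diag_big q).
  have := @CAP_a _ _ _ X_CAP i.+1 (p - i.+1) (q - i.+1); rewrite /diag /=.
  have -> : (q - i.+1).+1 = q - i by lia.
  by apply; lia.
- move=> p q i /andP[lt_ip lt_pq].
  have [lt_nq|le_qn] := ltnP n q; first by rewrite !(@diag_big q).
  have := @CAP_b _ _ _ X_CAP i.+1 (p - i.+1) (q - i.+1); rewrite /diag /=.
  have -> : (q - i.+1).+1 = q - i by lia.
  have -> : (p - i.+1).+1 = p - i by lia.
  by apply; lia.
Qed.

End DiagonalsOf.

End Patterns.

(** * Exchange of rows and antidiagonals, and the bijection *)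

Definition conj_rows (gamma : seq nat) (R : nat -> nat -> nat) p :=
  conjugate (part gamma p) (R p).

Definition conj_diags (D : nat -> nat -> nat) p := conjugate p (D p).

Lemma ltn_conj_rows gamma R p i j :
  rows_ok gamma R -> (j < conj_rows gamma R p i) = (i < R p j).
Proof.
by move=> ok; apply: ltn_conjugate => k;
  [apply: (rows_mono ok)|apply: (rows_out ok)].
Qed.

Lemma ltn_conj_diags gamma D p i j :
  diags_ok gamma D -> (i < conj_diags D p j) = (j < D p i).
Proof.
by move=> ok; rewrite ltn_conjugate // => k;
  [apply: (diags_mono ok)|apply: (diags_out ok)].
Qed.

Lemma conj_rows_ok gamma R :
  rows_ok gamma R -> diags_ok gamma (conj_rows gamma R).
Proof.
by move=> ok; exact: diags_of_rows (fun p i j => ltn_conj_rows p i j ok) ok.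
Qed.

Lemma conj_diags_ok gamma D : diags_ok gamma D -> rows_ok gamma (conj_diags D).
Proof.
move=> ok; apply: (rows_of_diags (D := D)) => // p i j.
by rewrite (ltn_conj_diags _ _ _ ok).
Qed.

Lemma eq_conjugate m h h' j : h =1 h' -> conjugate m h j = conjugate m h' j.
Proof. by move=> eq_h; apply: eq_count => v; rewrite eq_h. Qed.

Theorem theorem3p3p2 (n : nat) (gamma : n.-tuple nat) :
  exists f : seq (seq nat) -> seq (seq nat),
    set_bij (CT_first_col (flat gamma) (pos_parts gamma)) (CAP gamma) f.
Proof.
pose f U := triangle n (conj_rows gamma (row U)).
pose g X := tableau gamma (conj_diags (diag X)).
have gK U : CT_first_col (flat gamma) (pos_parts gamma) U -> g (f U) = U.
  move=> U_CT; have R_ok := row_ok U_CT; have D_ok := conj_rows_ok R_ok.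
  rewrite -[RHS](tableau_row U_CT); apply: eq_map => p; apply: eq_mkseq => j.
  (* Two conjugations cancel: [v] is below either entry exactly when
     [j < conj_rows gamma (row U) p v]. *)
  apply: ltn_ext => v.
  rewrite /conj_diags (eq_conjugate _ _ (h' := conj_rows gamma (row U) p)).
    by rewrite (ltn_conj_diags _ _ _ D_ok) ltn_conj_rows.
  by move=> i; rewrite (diag_triangle _ _ D_ok).
exists f; split.
- by move=> U /row_ok/conj_rows_ok; apply: triangle_CAP.
- by move=> U V; rewrite !inE => /gK {2}<- /gK {2}<- ->.
- move=> X X_CAP; have D_ok := diag_ok X_CAP; have R_ok := conj_diags_ok D_ok.
  (* [g] is also a right inverse, by the same double conjugation on each antidiagonal. *)
  exists (g X); first exact: tableau_CT.
  rewrite -[RHS](triangle_diag X_CAP).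
  apply: eq_mkseq => i; apply: eq_mkseq => j; apply: ltn_ext => v.
  rewrite /conj_rows (eq_conjugate _ _ (h' := conj_diags (diag X) (i + j).+1)).
    by rewrite ltn_conj_rows // (ltn_conj_diags _ _ _ D_ok).
  by move=> k; rewrite row_tableau.
Qed.
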